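(* Let $k,s,q$ be positive integers and for $(t,\eta,\xi)\in\mathbb{P}^3$ let $$g_{k,s}(t,\eta,\xi)=\sum_{\deg Y\le k-1}\sum_{\deg Z\le s-1}E(tYZ)\sum_{\deg U\le s-1}E(\eta YU)\sum_{\deg V\le s-1}E(\xi YV).$$ Then $g_{k,s}(t,\eta,\xi)=2^{3s+k-r(D^{[s;s;s]\times k}(t,\eta,\xi))}$ and $$\int_{\mathbb{P}\times\mathbb{P}\times\mathbb{P}}g_{k,s}^q(t,\eta,\xi)\,dt\,d\eta\,d\xi=2^{(3s+k)q}\cdot2^{-3k-3s+3}\sum_{i=0}^{\min(3s,k)}\Gamma_i^{[s;s;s]\times k}2^{-qi}.$$
   Context: $\mathbb{K}=\mathbb{F}_2((T^{-1}))$; $\mathbb{P}=\{\sum_{i\ge1}\alpha_iT^{-i}\}$ the unit interval with Haar measure of total mass $1$; $E(t)=(-1)^{\alpha_1}$, $\alpha_1$ the coefficient of $T^{-1}$. Sums run over polynomials in $\mathbb{F}_2[T]$ with the given degree bounds (zero included). For $t=\sum\alpha_iT^{-i}$, $\eta=\sum\beta_iT^{-i}$, $\xi=\sum\gamma_iT^{-i}$, $D^{[s;s;s]\times k}(t,\eta,\xi)$ is the $3s\times k$ matrix formed by stacking $(\alpha_{i+j-1})$, $(\beta_{i+j-1})$, $(\gamma_{i+j-1})$ ($1\le i\le s$, $1\le j\le k$); $r$ is rank over $\mathbb{F}_2$. $\Gamma_i^{[s;s;s]\times k}$ is the number of such $3s\times k$ matrices (three independent $s\times k$ persymmetric blocks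 over $\mathbb{F}_2$) of rank $i$. *)

(* Defs.v *)
From HB Require Import structures.
From mathcomp Require Import all_boot all_order all_algebra.
From mathcomp Require Import all_classical all_reals all_analysis.
From mathcomp Require Import zify.

Set Implicit Arguments.
Unset Strict Implicit.
Unset Printing Implicit Defensive.

Import Order.TTheory GRing.Theory Num.Theory.
Import numFieldNormedType.Exports.

Local Open Scope classical_set_scope.
Local Open Scope ring_scope.

(* F_2((T^-1)): lcoef x n is the coefficient of T^n in x. *)
Record laurent := Laurent {
  lcoef : int -> 'F_2 ;
  lcoef_bounded : exists N : int, forall n : int, N < n -> lcoef n = 0 }.

(* Cauchy product. The sum has finite support: x_i = 0 for i large and
   y_(n-i) = 0 for i very negative. *)
Definition lmul_coef (x y : laurent) (n : int) : 'F_2 :=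
  \sum_(i \in [set: int]) lcoef x i * lcoef y (n - i).

Lemma lmul_coef_bounded (x y : laurent) :
  exists N : int, forall n : int, N < n -> lmul_coef x y n = 0.
Proof.
have [M xM] := lcoef_bounded x; have [N yN] := lcoef_bounded y.
exists (M + N) => n ltn; apply: fsbig1 => i _.
have [leiM|ltMi] := leP i M; last by rewrite xM // mul0r.
by rewrite yN ?mulr0 // ltrBrDr (le_lt_trans _ ltn) // addrC lerD2r.
Qed.

Definition lmul (x y : laurent) : laurent :=
  Laurent (lmul_coef_bounded x y).

Definition lpoly_coef (p : {poly 'F_2}) (n : int) : 'F_2 :=
  if n is Posz m then p`_m else 0.

Lemma lpoly_coef_bounded (p : {poly 'F_2}) :
  exists N : int, forall n : int, N < n -> lpoly_coef p n = 0.
Proof.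
by exists (size p)%:Z => -[m|m] //=; rewrite ltz_nat => /ltnW/leq_sizeP->.
Qed.

Definition lpoly (p : {poly 'F_2}) : laurent :=
  Laurent (lpoly_coef_bounded p).

(* The unit interval: t stands for \sum_(i >= 1) alpha_i T^-i with
   alpha_i = t i.-1, i.e. indices are shifted down by one. *)
Definition unitI : Type := nat -> 'F_2.

HB.instance Definition _ := GRing.Zmodule.on unitI.
HB.instance Definition _ := isPointed.Build unitI 0.

Definition lunitI_coef (t : unitI) (n : int) : 'F_2 :=
  if n is Negz m then t m else 0.

Lemma lunitI_coef_bounded (t : unitI) :
  exists N : int, forall n : int, N < n -> lunitI_coef t n = 0.
Proof. by exists 0; case. Qed.

Definition lunitI (t : unitI) : laurent :=
  Laurent (lunitI_coef_bounded t).

Definition charE (R : realType) (x : laurent) : R :=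
  (-1) ^+ (lcoef x (- 1) : nat).

(* The ball {u : |u - t| < 2^-n} for the absolute value with |T| = 2:
   the first n coefficients of u and t agree. *)
Definition unitI_ball (t : unitI) (n : nat) : set unitI :=
  [set u | forall i, (i < n)%N -> u i = t i].

Definition unitI_open : set (set unitI) :=
  [set A | forall t, A t -> exists n, unitI_ball t n `<=` A].

(* The unit interval with its Borel sigma-algebra. *)
Notation PP := (g_sigma_algebraType unitI_open).

(* A probability measure on Borel sets that is invariant under translations
   of the additive group; it is unique, and it exists (haar_is_haar below). *)
Definition is_haar (R : realType) (mu : probability PP R) : Prop :=
  forall (t : unitI) (A : set PP), measurable A ->
    mu [set t + u | u in (A : set unitI)] = mu A.

(* deg Y <= k - 1, zero included, is size Y <= k. *)
Definition gsum (R : realType) (k s : nat) (t eta xi : unitI) : R :=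
  \sum_(Y : {poly_k 'F_2})
    ((\sum_(Z : {poly_s 'F_2}) charE R (lmul (lunitI t) (lpoly (val Y * val Z)))) *
     (\sum_(U : {poly_s 'F_2}) charE R (lmul (lunitI eta) (lpoly (val Y * val U)))) *
     (\sum_(V : {poly_s 'F_2}) charE R (lmul (lunitI xi) (lpoly (val Y * val V))))).

(* With 0-based indices the (i, j) entry alpha_(i+j-1) is t (i + j). *)
Definition persym_mx (s k : nat) (t : unitI) : 'M['F_2]_(s, k) :=
  \matrix_(i < s, j < k) t (i + j)%N.

Definition Dmx (s k : nat) (t eta xi : unitI) : 'M['F_2]_(s + s + s, k) :=
  col_mx (col_mx (persym_mx s k t) (persym_mx s k eta)) (persym_mx s k xi).

Definition persymmetric (s k : nat) (A : 'M['F_2]_(s, k)) : bool :=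
  [forall i : 'I_s, forall j : 'I_k, forall i' : 'I_s, forall j' : 'I_k,
    (i + j == i' + j')%N ==> (A i j == A i' j')].

Definition Gamma (s k i : nat) : nat :=
  #|[set M : 'M['F_2]_(s + s + s, k) |
      [&& persymmetric (usubmx (usubmx M)), persymmetric (dsubmx (usubmx M)),
          persymmetric (dsubmx M) & \rank M == i]]%SET|.

(* The rest of the file shows that a Haar probability measure exists: it is
   the image of Lebesgue measure on [0, 1[ under binary expansion. *)
Section haar_exists.
Variable R : realType.

Lemma unitI_ball_open t n : unitI_open (unitI_ball t n).
Proof. by move=> u tu; exists n => v uv i ltin; rewrite uv // tu. Qed.

Lemma unitI_open_bigcup (A : set unitI) : unitI_open A ->
  A = \bigcup_(w : seq 'F_2)
    (if `[< unitI_ball (nth 0 w) (size w) `<=` A >]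
     then unitI_ball (nth 0 w) (size w) else set0).
Proof.
move=> oA; apply/seteqP; split=> [t At|t [w _]]; last first.
  by case: asboolP => // + wt; exact.
have [n nA] := oA _ At; exists (mkseq t n) => //.
have -> : unitI_ball (nth 0 (mkseq t n)) (size (mkseq t n)) = unitI_ball t n.
  rewrite size_mkseq; apply/seteqP; split=> u tu i ltin;
  by rewrite tu // nth_mkseq.
by case: asboolP.
Qed.

Definition unitI_balls : set (set unitI) :=
  [set A | A = set0 \/ exists t n, A = unitI_ball t n].

Lemma unitI_balls_setI : setI_closed unitI_balls.
Proof.
move=> A B [->|[t [n ->]]]; first by left; rewrite set0I.
case=> [->|[u [m ->]]]; first by left; rewrite setI0.
have [->|/set0P[v [tv uv]]] := eqVneq (unitI_ball t n `&` unitI_ball u m) set0.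
  by left.
right; exists v, (maxn n m); apply/seteqP; split=> w.
  move=> [tw uw] i; rewrite leq_max => /orP[] lti.
    by rewrite tw // tv.
  by rewrite uw // uv.
by move=> vw; split=> i lti; (rewrite vw; last by rewrite leq_max lti ?orbT);
  [exact: tv|exact: uv].
Qed.

Lemma measurable_unitI_balls : @measurable _ PP = <<s unitI_balls >>.
Proof.
apply/seteqP; split; apply: smallest_sub; do ?exact: smallest_sigma_algebra.
  move=> A oA; rewrite (unitI_open_bigcup oA).
  apply: (@countable_bigcupT_measurable _ (g_sigma_algebraType unitI_balls)).
    exact: countableP.
  move=> w; case: ifP => _; last exact: measurable0.
  by apply: sub_sigma_algebra; right; exists (nth 0 w), (size w).
move=> A [->|[t [n ->]]]; first exact: measurable0.
by apply: sub_sigma_algebra; exact: unitI_ball_open.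
Qed.

Definition binary_digits (x : measurableTypeR R) : PP := fun n =>
  if 0 <= x < 1 then (Num.trunc (2 ^+ n.+1 * x))%:R else 0.

Fixpoint ball_code (t : unitI) (n : nat) : nat :=
  if n is m.+1 then ((ball_code t m).*2 + t m)%N else 0%N.

Lemma binary_digitsP x t n : 0 <= x < 1 ->
  unitI_ball t n (binary_digits x) <-> Num.trunc (2 ^+ n * x) = ball_code t n.
Proof.
move=> x01; have /andP[x0 x1] := x01.
elim: n => [|n IHn].
  split=> // _; rewrite expr0 mul1r; apply: truncn_def.
  by rewrite x0.
have -> : unitI_ball t n.+1 (binary_digits x) <->
    unitI_ball t n (binary_digits x) /\ binary_digits x n = t n.
  split=> [tx|[tx txn] i]; first by split=> [i lti|]; apply: tx => //; exact: ltnW.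
  by rewrite ltnS leq_eqVlt => /predU1P[->//|/tx].
rewrite IHn /binary_digits x01 /=.
set a := Num.trunc (2 ^+ n * x); set b := Num.trunc _; set c := ball_code t n.
have ab : (a.*2 <= b < a.*2.+2)%N.
  have y0 : 0 <= 2 ^+ n * x by rewrite mulr_ge0 // exprn_ge0.
  have /andP[ay ya] := truncn_itv y0.
  have z0 : 0 <= 2 ^+ n.+1 * x by rewrite mulr_ge0 // exprn_ge0.
  rewrite truncn_ge_nat // truncn_lt_nat // -doubleS -!muln2 !natrM.
  by rewrite exprSr mulrAC ler_pM2r ?ltr_pM2r // ay ya.
have tb : (b%:R = t n) <-> (b %% 2 = t n)%N.
  split=> [<-|btn]; first by rewrite val_Fp_nat.
  by apply: val_inj => /=; rewrite val_Fp_nat.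
have t2 : (t n < 2)%N by rewrite (leq_trans (ltn_ord (t n))).
rewrite tb; move: (nat_of_ord (t n)) t2 => d d2; lia.
Qed.

Lemma preimage_ball t n :
  (binary_digits @^-1` unitI_ball t n) `&` `[0, 1[%classic =
  `[(ball_code t n)%:R / 2 ^+ n, (ball_code t n).+1%:R / 2 ^+ n[%classic.
Proof.
have p2 : 0 < 2 ^+ n :> R by rewrite exprn_gt0.
have code_lt : (ball_code t n < 2 ^ n)%N.
  elim: n {p2} => //= n IHn; rewrite expnS.
  have t2 : (t n < 2)%N by rewrite (leq_trans (ltn_ord (t n))).
  lia.
apply/seteqP; split=> x /=.
  rewrite in_itv /= => -[tx x01]; have /andP[x0 _] := x01.
  have := (binary_digitsP t n x01).1 tx => /eqP.
  rewrite truncn_eq ?mulr_ge0 ?(ltW p2) // in_itv /=.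
  by rewrite ler_pdivrMr // ltr_pdivlMr // mulrC.
rewrite !in_itv /= ler_pdivrMr // ltr_pdivlMr // => cx.
have x01 : 0 <= x < 1.
  move: cx => /andP[cx xc]; apply/andP; split.
    by rewrite -(pmulr_lge0 _ p2) (le_trans _ cx).
  by rewrite -(ltr_pM2r p2) (lt_le_trans xc) // mul1r -natrX ler_nat.
split=> //; apply/(binary_digitsP t n x01); apply: truncn_def.
by rewrite mulrC.
Qed.

Lemma measurable_binary_digits : measurable_fun setT binary_digits.
Proof.
apply: (@measurability _ _ _ PP _ _ unitI_balls measurable_unitI_balls).
move=> _ [A + <-]; rewrite setTI => -[->|[t [n ->]]].
  by rewrite preimage_set0.
rewrite -(setIT (_ @^-1` _)) -(setUv `[0, 1[%classic) setIUr; apply: measurableU.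
  by rewrite preimage_ball.
have [t0|t0] := pselect (unitI_ball t n (0 : unitI)).
  rewrite setIidr; first exact: measurableC.
  move=> x /= /negP; rewrite in_itv /= => /negbTE x01 i lti.
  by rewrite /binary_digits x01 -t0.
rewrite [X in measurable X](_ : _ = set0) // -subset0 => x [/= tx].
move=> /negP; rewrite in_itv /= => /negbTE x01; apply: t0 => i lti.
by rewrite -tx // /binary_digits x01.
Qed.

HB.instance Definition _ :=
  @isMeasurableFun.Build _ _ _ _ binary_digits measurable_binary_digits.

Definition lebesgue01 : set (measurableTypeR R) -> \bar R :=
  mrestr (@lebesgue_measure R) (measurable_itv `[0, 1[).

HB.instance Definition _ := Measure.copy lebesgue01
  (mrestr (@lebesgue_measure R) (measurable_itv `[0, 1[)).

Lemma lebesgue01_setT : lebesgue01 setT = 1%E.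
Proof.
by rewrite /lebesgue01 /mrestr setTI lebesgue_measure_itv /= lte_fin ltr01 sube0.
Qed.

HB.instance Definition _ :=
  Measure_isProbability.Build _ _ _ lebesgue01 lebesgue01_setT.

Definition haar : probability PP R := distribution lebesgue01 binary_digits.

Lemma haar_ball t n : haar (unitI_ball t n) = (2 ^- n)%:E.
Proof.
rewrite /haar /= /distribution /pushforward /lebesgue01 /mrestr.
rewrite preimage_ball lebesgue_measure_itv /= lte_fin.
rewrite ltr_pM2r ?invr_gt0 ?exprn_gt0 // ltr_nat ltnSn.
by rewrite -EFinD -mulrBl -natrB // subSnn mul1r.
Qed.

Definition translate (t : unitI) (u : PP) : PP := ((u : unitI) - t)%R.

Lemma translate_ball t u n :
  translate t @^-1` unitI_ball u n = unitI_ball (u + t) n.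
Proof.
apply/seteqP; split=> v uv i lti; have := uv i lti; rewrite /translate.
  by move=> /eqP; rewrite subr_eq => /eqP.
by move=> /eqP; rewrite -subr_eq => /eqP.
Qed.

Lemma measurable_translate t : measurable_fun setT (translate t).
Proof.
apply: (@measurability _ _ _ PP _ _ unitI_balls measurable_unitI_balls).
move=> _ [A + <-]; rewrite setTI => -[->|[u [n ->]]].
  by rewrite preimage_set0.
by rewrite translate_ball; apply: sub_sigma_algebra; exact: unitI_ball_open.
Qed.

HB.instance Definition _ t :=
  @isMeasurableFun.Build _ _ _ _ (translate t) (measurable_translate t).

Lemma haar_is_haar : is_haar haar.
Proof.
move=> t A mA; transitivity (distribution haar (translate t) A).
  rewrite /distribution /pushforward; congr (haar _).
  apply/seteqP; split=> [_ [u Au <-]|u Au] /=.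
    by rewrite /translate addrC addKr.
  by exists (translate t u) => //; rewrite /translate addrC subrK.
apply: (@measure_unique _ R PP unitI_balls (fun=> setT)) => //.
- exact: measurable_unitI_balls.
- exact: unitI_balls_setI.
- by move=> _; right; exists 0, 0%N; apply/seteqP; split.
- by apply/seteqP; split=> // x _; exists 0%N.
- move=> B [->|[u [n ->]]]; first by rewrite !measure0.
  transitivity (haar (translate t @^-1` unitI_ball u n)) => //.
  by rewrite translate_ball haar_ball; symmetry; exact: haar_ball.
- move=> _; apply: (le_lt_trans (probability_le1 _ measurableT)).
  exact: ltry.
Qed.

End haar_exists.

(* Main.v *)
Require Import Defs.
From HB Require Import structures.
From mathcomp Require Import all_boot all_order all_algebra.
From mathcomp Require Import all_classical all_reals all_analysis.
From mathcomp Require Import measurable_realfun mxabelem zify lra.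
Import Order.TTheory GRing.Theory Num.Theory.
Import numFieldNormedType.Exports.
Local Open Scope classical_set_scope.
Local Open Scope ring_scope.

(* The coefficient of T^-1 in tYZ is z P y^T, where P is the persymmetric s x k
   matrix of t and y, z are the coefficient rows of Y, Z. Hence the sum over Z is
   a character sum, equal to 2^s if P y^T = 0 and to 0 otherwise, and g is 2^(3s)
   times the number of y in the kernel of the stacked matrix D.
   For the integral, D depends only on the first n = s + k - 1 digits of t, eta
   and xi. Haar measure gives every ball of n prescribed digits mass 2^-n, so the
   integral is 2^(-3n) times a sum over triples of words of length n, and these
   triples are in bijection with the triples of persymmetric blocks. *)

(** * The coefficient of T^-1 as a bilinear form *)

Lemma lcoef_lmul_lunitI_lpoly (t : unitI) (p : {poly 'F_2}) (n : nat) :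
  (size p <= n)%N ->
  lcoef (lmul (lunitI t) (lpoly p)) (- 1) = \sum_(j < n) t j * p`_j.
Proof.
(* [Negz m] is -(m + 1), so in the Cauchy product at -1 the digit [t m] meets the coefficient of
   T^m. *)
have N1E m : -1 - Negz m = m%:Z by lia.
move=> pn; rewrite (fsbig_ord _ n (fun j => t j * p`_j)) /= /lmul_coef.
rewrite -(@fsbig_widen _ _ _ _ (Negz @` `I_n)) //=.
  rewrite (@reindex_fsbig _ _ _ _ _ Negz `I_n).
    by apply: eq_fsbigr => j _; rewrite N1E.
  by split=> // i j _ _ [].
move=> [m|m] [_ /= nm]; first by rewrite mul0r.
change (t m * lpoly_coef p (-1 - Negz m) = 0).
rewrite N1E /= nth_default ?mulr0 // (leq_trans pn) // leqNgt; apply/negP => mn.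
by apply: nm; exists m.
Qed.

Lemma lcoef_lmul_lunitI_mul (t : unitI) (k s : nat)
    (Y : {poly_k 'F_2}) (Z : {poly_s 'F_2}) :
  lcoef (lmul (lunitI t) (lpoly (val Y * val Z))) (- 1)
  = (npoly_rV Z *m persym_mx s k t *m (npoly_rV Y)^T) 0 0.
Proof.
have sY : (size (val Y) <= k)%N by exact: (valP Y).
have sZ : (size (val Z) <= s)%N by exact: (valP Z).
rewrite (@lcoef_lmul_lunitI_lpoly _ _ (k + s)); last first.
  by rewrite (leq_trans (size_polyMleq _ _)) //; lia.
(* Expanding Z in monomials reduces the product YZ to shifts of Y by [i]. *)
have ZE : val Z = \sum_(i < s) (val Z)`_i *: 'X^i.
  by rewrite -poly_def; apply/polyP => i; rewrite coef_poly; case: ltnP => // si;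
    rewrite nth_default // (leq_trans sZ).
rewrite -mulmxA mxE.
transitivity (\sum_(j < k + s) \sum_(i < s)
    t j * ((val Z)`_i * (val Y * 'X^i)`_j)).
  apply: eq_bigr => j _; rewrite [in LHS]ZE mulr_sumr coef_sum mulr_sumr.
  by apply: eq_bigr => i _; rewrite -scalerAr coefZ.
rewrite exchange_big /=; apply: eq_bigr => i _; rewrite !mxE mulr_sumr.
have ik : (i <= k + s)%N by have := ltn_ord i; lia.
(* Only the window i <= j < i + k survives: below it the shift by 'X^i gives 0, above it the degree
   of Y is exceeded. Reindexing by j - i then produces the entries t (i + j). *)
rewrite -(big_mkord xpredT (fun j => t j * ((val Z)`_i * (val Y * 'X^i)`_j))).
rewrite (big_cat_nat (leq0n _) ik) /= big_nat big1 ?add0r; last first.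
  by move=> j /andP[_ ji]; rewrite coefMXn ji !mulr0.
have iki : (i <= i + k)%N by rewrite leq_addr.
have iks : (i + k <= k + s)%N by have := ltn_ord i; lia.
rewrite (big_cat_nat iki iks) /=.
rewrite [X in _ + X]big_nat [X in _ + X]big1 ?addr0; last first.
  move=> j /andP[ikj _]; rewrite coefMXn ltnNge (leq_trans iki ikj) /=.
  by rewrite (nth_default _ (_ : (size (val Y) <= j - i)%N)) ?mulr0 //; lia.
rewrite -{1}(add0n (i : nat)) (addnC i) big_addn addnK big_mkord.
apply: eq_bigr => j _; rewrite !mxE coefMXn ltnNge leq_addl /= addnK.
by rewrite (addnC j) mulrCA.
Qed.

(** * Character sums and the rank formula *)

Lemma signr_F2D {R : realType} (a b : 'F_2) :
  (-1) ^+ (a + b)%R = (-1) ^+ a * (-1) ^+ b :> R.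
Proof.
by case: a b => [[|[|a]] //= ?] [[|[|b]] //= ?];
  rewrite ?expr0 ?expr1 ?mulr1 ?mul1r ?mulrNN ?mulr1.
Qed.

Lemma sum_signr_mulmx {R : realType} (s : nat) (c : 'cV['F_2]_s) :
  \sum_(z : 'rV['F_2]_s) (-1) ^+ ((z *m c) 0 0) = 2 ^+ s * (c == 0)%:R :> R.
Proof.
have [->|/eqP c0] := eqVneq c 0.
  under eq_bigr do rewrite mulmx0 mxE expr0.
  by rewrite sumr_const card_mx card_Fp // mul1n mulr1 -[RHS]natrX.
have [i ci] : exists i, c i 0 = 1.
  apply: contrapT => /forallNP ci; apply: c0; apply/matrixP => i j.
  rewrite ord1 !mxE; apply/eqP; have := ci i.
  by case: (c i 0) => [[|[|a]] //= ?] H; exfalso; apply: H; exact: val_inj.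
(* Translating [z] by the basis vector [delta_mx 0 i], where c i = 1, flips every sign; the sum
   equals its opposite and so vanishes. *)
rewrite mulr0; apply/eqP; rewrite -eqNr eq_sym; apply/eqP.
rewrite [LHS](reindex_inj (addrI (delta_mx 0 i))) -sumrN.
apply: eq_bigr => z _; rewrite mulmxDl mxE signr_F2D -rowE mxE ci expr1.
by rewrite mulN1r.
Qed.

Lemma npoly_rV_bij {R : nzSemiRingType} {n : nat} :
  bijective (@npoly_rV R n).
Proof. by exists (@rVnpoly R n); [exact: npoly_rV_K|exact: rVnpolyK]. Qed.

Lemma sum_charE_npoly {R : realType} (t : unitI) (k s : nat)
    (Y : {poly_k 'F_2}) :
  \sum_(Z : {poly_s 'F_2}) charE R (lmul (lunitI t) (lpoly (val Y * val Z)))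
  = 2 ^+ s * (persym_mx s k t *m (npoly_rV Y)^T == 0)%:R.
Proof.
rewrite -sum_signr_mulmx (reindex (@npoly_rV _ _)) /=; last first.
  exact/onW_bij/npoly_rV_bij.
by apply: eq_bigr => Z _; rewrite /charE lcoef_lmul_lunitI_mul mulmxA.
Qed.

(** After transposition the solutions are the row space of [kermx A^T], of dimension n - rank A. *)
Lemma card_mulmx_eq0 (F : finFieldType) (m n : nat) (A : 'M[F]_(m, n)) :
  #|[pred y : 'rV[F]_n | A *m y^T == 0]| = (#|F| ^ (n - \rank A))%N.
Proof.
rewrite -mxrank_tr -mxrank_ker -card_rowg; apply: eq_card => y.
by rewrite [RHS]mem_rowg inE sub_kermx -trmx_eq0 trmx_mul trmxK.
Qed.

Lemma gsum_rank {R : realType} (k s : nat) (t eta xi : unitI) :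
  gsum R k s t eta xi
  = 2 ^ ((3 * s + k)%N%:Z - (\rank (Dmx s k t eta xi))%:Z).
Proof.
set D := Dmx s k t eta xi.
transitivity (\sum_(y : 'rV['F_2]_k) 2 ^+ (3 * s) * (D *m y^T == 0)%:R : R).
  rewrite (reindex (@npoly_rV _ _)) /=; last exact/onW_bij/npoly_rV_bij.
  (* D y^T stacks the three block products, so the three indicators multiply to the indicator of D
     y^T = 0. *)
  apply: eq_bigr => Y _; rewrite !sum_charE_npoly !mul_col_mx !col_mx_eq0.
  rewrite -!mulnb !natrM [X in X * _ = _]mulrACA [LHS]mulrACA -!exprD.
  by rewrite (_ : 3 * s = s + s + s)%N //; lia.
rewrite -mulr_sumr -natr_sum.
rewrite (_ : (\sum_y _)%N = #|[pred y : 'rV['F_2]_k | D *m y^T == 0]|); last first.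
  by rewrite -sum1_card [RHS]big_mkcond; apply: eq_bigr => y _; rewrite inE; case: eqP.
rewrite card_mulmx_eq0 card_Fp // natrX -exprD.
rewrite exprnP; congr (_ ^ _).
by rewrite addnBA ?rank_leq_col // subzn // (leq_trans (rank_leq_col _)) // leq_addl.
Qed.

(** * Haar measure of balls and integrals of functions of finitely many digits *)

Lemma measurable_unitI_ball (t : unitI) (n : nat) :
  measurable (unitI_ball t n : set PP).
Proof. by apply: sub_sigma_algebra; exact: unitI_ball_open. Qed.

Lemma haar_ball_eq {R : realType} {mu : probability PP R} (t : unitI)
    (n : nat) : is_haar mu -> mu (unitI_ball t n) = mu (unitI_ball 0 n).
Proof.
move=> /(_ t _ (measurable_unitI_ball 0 n)) <-; congr (mu _).
apply/seteqP; split=> [u tu|_ [u u0 <-] i lti].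
  exists (u - t); last by rewrite addrC subrK.
  by move=> i lti; rewrite -[LHS]/(u i - t i) tu // subrr.
by rewrite -[LHS]/(t i + u i) u0 // addr0.
Qed.

(** Fixing one more digit splits a ball into two disjoint translates of each other, so each step
    halves the mass, starting from total mass 1. *)
Lemma haar_ballE {R : realType} {mu : probability PP R} (t : unitI) (n : nat) :
  is_haar mu -> mu (unitI_ball t n) = (2 ^- n)%:E.
Proof.
move=> mu_haar; rewrite haar_ball_eq //; elim: n => [|n IHn].
  rewrite (_ : unitI_ball 0 0 = setT) ?probability_setT ?expr0 ?invr1 //.
  by apply/seteqP; split.
pose e : unitI := fun i => (i == n)%:R.
have ballU : unitI_ball 0 n = unitI_ball 0 n.+1 `|` unitI_ball e n.+1.
  apply/seteqP; split=> u; last first.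
    case=> u0 i lti; rewrite u0 //; first exact: ltnW.
    - by rewrite /e (ltn_eqF lti).
    - exact: ltnW.
  move=> u0; have [un|un] := eqVneq (u n) 0.
    by left=> i; rewrite ltnS leq_eqVlt => /predU1P[->//|/u0].
  right=> i; rewrite ltnS leq_eqVlt /e => /predU1P[->|lti].
    rewrite eqxx; apply: val_inj; move: un.
    by case: (u n) => [[|[|a]] //= ?].
  by rewrite (ltn_eqF lti) u0.
have ball0 : unitI_ball 0 n.+1 `&` unitI_ball e n.+1 = set0.
  rewrite -subset0 => u [u0 ue]; have := ue n (ltnSn n).
  by rewrite u0 // /e eqxx => /eqP; rewrite eq_sym oner_eq0.
have H :
    mu (unitI_ball 0 n) = (mu (unitI_ball 0%R n.+1) + mu (unitI_ball 0%R n.+1))%E.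
  rewrite -[X in (_ = _ + X)%E](haar_ball_eq e) // ballU measureU //;
  exact: measurable_unitI_ball.
have fin : mu (unitI_ball 0 n.+1) \is a fin_num.
  by rewrite fin_num_measure //; exact: measurable_unitI_ball.
move: H; rewrite IHn -(fineK fin) -EFinD => -[] H; congr EFin.
by rewrite exprS invfM H; lra.
Qed.

(** [{poly_n 'F_2}] serves as the finite type of words of length [n]; a word is completed by zero
    digits. *)
Definition npolyI {n : nat} (p : {poly_n 'F_2}) : unitI := fun i => (val p)`_i.

Definition truncI (n : nat) (t : unitI) : {poly_n 'F_2} :=
  npolyp n (\poly_(i < n) t i).

Lemma npolyI_truncI (n : nat) (t : unitI) (i : nat) :
  (i < n)%N -> npolyI (truncI n t) i = t i.
Proof. by move=> lti; rewrite /npolyI coef_npolyp coef_poly lti. Qed.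

Lemma unitI_ball_npolyI (n : nat) (p : {poly_n 'F_2}) (t : unitI) :
  unitI_ball (npolyI p) n t <-> p = truncI n t.
Proof.
split=> [pt|-> i lti]; last by rewrite npolyI_truncI.
apply/npolyP => i; have [lti|nei] := ltnP i n.
  by rewrite -[RHS]/(npolyI _ i) npolyI_truncI // pt.
by rewrite !big_coef_npoly.
Qed.

(** Such an [f] is constant on products of three balls, hence a finite combination of their
    indicators, which also settles measurability. *)
Lemma haar3_integral {R : realType} {mu : probability PP R} (n : nat)
    (f : unitI -> unitI -> unitI -> R) :
  is_haar mu -> (forall t u v, 0 <= f t u v) ->
  (forall t u v, f t u v
     = f (npolyI (truncI n t)) (npolyI (truncI n u)) (npolyI (truncI n v))) ->
  (\int[(mu \x mu) \x mu]_x (f x.1.1 x.1.2 x.2)%:E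
   = (2 ^- (3 * n) * \sum_(w : {poly_n 'F_2} * {poly_n 'F_2} * {poly_n 'F_2})
        f (npolyI w.1.1) (npolyI w.1.2) (npolyI w.2))%:E)%E.
Proof.
move=> mu_haar f_ge0 f_trunc.
pose W := ({poly_n 'F_2} * {poly_n 'F_2} * {poly_n 'F_2})%type.
pose F (w : W) : R := f (npolyI w.1.1) (npolyI w.1.2) (npolyI w.2).
pose B (p : {poly_n 'F_2}) : set PP := unitI_ball (npolyI p) n.
pose C (w : W) : set (PP * PP * PP) := (B w.1.1 `*` B w.1.2) `*` B w.2.
have mB p : measurable (B p) by exact: measurable_unitI_ball.
have mC w : measurable (C w) by do 2?apply: measurableX.
transitivity (\int[(mu \x mu) \x mu]_x
    (\sum_(w : W) (F w)%:E * (\1_(C w) x)%:E)%E)%E.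
  apply: eq_integral => -[[t u] v] _ /=; rewrite f_trunc.
  (* Each point lies in exactly one cell [C w], the one given by its truncations. *)
  rewrite (bigD1 (truncI n t, truncI n u, truncI n v)) //= big1 ?adde0.
    rewrite /C indicE mem_set ?mule1 // /F.
    by do !split => /=; apply/unitI_ball_npolyI.
  move=> [[p1 p2] p3] /eqP pn; rewrite indicE memNset ?mule0 // => -[[]].
  rewrite /= /B !unitI_ball_npolyI => e1 e2 e3.
  by apply: pn; rewrite e1 e2 e3.
rewrite ge0_integral_sum //; last 2 first.
- move=> w; apply: measurable_funeM.
  exact/measurable_EFinP/measurable_indic.
- by move=> w x _; apply: mule_ge0; rewrite lee_fin //; exact: f_ge0.
rewrite mulr_sumr -sumEFin; apply: eq_bigr => w _.
rewrite ge0_integralZl //; last 2 first.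
- exact/measurable_EFinP/measurable_indic.
- by rewrite lee_fin; exact: f_ge0.
have mBB : measurable (B w.1.1 `*` B w.1.2) by exact: measurableX.
have muB p : mu (B p) = (2 ^- n)%:E by exact: haar_ballE.
have muBB : (mu \x mu)%E (B w.1.1 `*` B w.1.2) = (2 ^- n * 2 ^- n)%:E.
  apply: (etrans (product_measure1E mu mu (mB _) (mB _))).
  by rewrite EFinM; congr (_ * _)%E; exact: muB.
have muC : ((mu \x mu) \x mu)%E (C w) = (2 ^- n * 2 ^- n * 2 ^- n)%:E.
  apply: (etrans (product_measure1E (mu \x mu)%E mu mBB (mB w.2))).
  by rewrite EFinM; congr (_ * _)%E; [exact: muBB|exact: muB].
rewrite integral_indic // setIT [X in (_ * X)%E]muC -EFinM mulrC.
by rewrite -!invfM -!exprD (_ : n + n + n = 3 * n)%N //; lia.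
Qed.

(** * Persymmetric blocks and words of digits *)

Definition persym3 (s k : nat) (M : 'M['F_2]_(s + s + s, k)) : bool :=
  [&& persymmetric (usubmx (usubmx M)), persymmetric (dsubmx (usubmx M))
    & persymmetric (dsubmx M)].

Lemma persymmetricP {s k : nat} {A : 'M['F_2]_(s, k)} :
  reflect (forall (i : 'I_s) (j : 'I_k) (i' : 'I_s) (j' : 'I_k),
       (i + j = i' + j')%N -> A i j = A i' j')
    (persymmetric A).
Proof.
apply: (iffP 'forall_'forall_'forall_'forall_implyP) => AP i j i' j'.
  by move/eqP/AP/eqP.
by move/eqP/AP/eqP.
Qed.

Lemma persymmetric_persym_mx (s k : nat) (t : unitI) :
  persymmetric (persym_mx s k t).
Proof. by apply/persymmetricP => i j i' j' e; rewrite !mxE e. Qed.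

(** The largest index used is (s - 1) + (k - 1). *)
Lemma eq_persym_mx (s k : nat) (t u : unitI) :
  (forall i, (i < (s + k).-1)%N -> t i = u i) ->
  persym_mx s k t = persym_mx s k u.
Proof.
move=> tu; apply/matrixP => i j; rewrite !mxE tu //.
by have := ltn_ord i; have := ltn_ord j; lia.
Qed.

(** Each antidiagonal is read once, along the top row and then down the last column. The successor
    sizes make this row and column exist. *)
Definition persym_digits {s k : nat} (A : 'M['F_2]_(s.+1, k.+1)) : unitI :=
  fun m => if (m <= k)%N then A ord0 (inord m) else A (inord (m - k)) ord_max.

Lemma persym_digitsK {s k : nat} (A : 'M['F_2]_(s.+1, k.+1)) :
  persymmetric A -> persym_mx s.+1 k.+1 (persym_digits A) = A.
Proof.
move=> /persymmetricP AP; apply/matrixP => i j; rewrite mxE /persym_digits.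
have := ltn_ord i; have := ltn_ord j => jk i_s; case: leqP => ijk; apply: AP.
  by rewrite inordK.
by rewrite inordK /=; lia.
Qed.

Lemma persym_mxK {s k : nat} (t : unitI) (m : nat) :
  (m < (s.+1 + k.+1).-1)%N -> persym_digits (persym_mx s.+1 k.+1 t) m = t m.
Proof.
move=> mN; rewrite /persym_digits; case: leqP => mk; rewrite mxE inordK //=.
  by rewrite subnK // ltnW.
by lia.
Qed.

Lemma sum_npolyI_Dmx {V : nmodType} (s k : nat)
    (f : 'M['F_2]_(s.+1 + s.+1 + s.+1, k.+1) -> V)
    (n := (s.+1 + k.+1).-1) :
  \sum_(w : {poly_n 'F_2} * {poly_n 'F_2} * {poly_n 'F_2})
    f (Dmx s.+1 k.+1 (npolyI w.1.1) (npolyI w.1.2) (npolyI w.2))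
  = \sum_(M | persym3 s.+1 k.+1 M) f M.
Proof.
(* On persymmetric blocks, [c] inverts the passage from words to matrices; it is applied to each of
   the three blocks. *)
pose c (A : 'M['F_2]_(s.+1, k.+1)) := truncI n (persym_digits A).
have cK A : persymmetric A -> persym_mx s.+1 k.+1 (npolyI (c A)) = A.
  move=> AP; rewrite -[RHS]persym_digitsK //; apply: eq_persym_mx => i lti.
  by rewrite npolyI_truncI.
have Kc p : c (persym_mx s.+1 k.+1 (npolyI p)) = p.
  by apply/esym/unitI_ball_npolyI => i lti; rewrite persym_mxK.
symmetry; rewrite (reindex_onto
  (fun w : {poly_n 'F_2} * {poly_n 'F_2} * {poly_n 'F_2} =>
     Dmx s.+1 k.+1 (npolyI w.1.1) (npolyI w.1.2) (npolyI w.2))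
  (fun M => (c (usubmx (usubmx M)), c (dsubmx (usubmx M)), c (dsubmx M)))).
  apply: eq_bigl => -[[p1 p2] p3] /=.
  rewrite /persym3 /Dmx !(col_mxKu, col_mxKd) !Kc eqxx andbT.
  by rewrite !persymmetric_persym_mx.
by move=> M /and3P[P1 P2 P3]; rewrite /Dmx /= !cK // !vsubmxK.
Qed.

Lemma sum_persym3_rank {R : pzSemiRingType} (s k : nat) (f : nat -> R) :
  \sum_(M | persym3 s k M) f (\rank M)
  = \sum_(0 <= i < (minn (3 * s) k).+1) (Gamma s k i)%:R * f i.
Proof.
have rk (M : 'M['F_2]_(s + s + s, k)) : (\rank M < (minn (3 * s) k).+1)%N.
  rewrite ltnS leq_min rank_leq_col andbT (leq_trans (rank_leq_row _)) //; lia.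
(* Group the matrices by rank; each fibre is counted by [Gamma]. *)
rewrite big_mkord (partition_big (fun M => Ordinal (rk M)) xpredT) //=.
apply: eq_bigr => i _; rewrite /Gamma -sum1_card natr_sum mulr_suml.
apply: eq_big => [M|M /andP[_ /eqP <-]]; last by rewrite mul1r.
by rewrite inE /persym3 -!andbA.
Qed.

Theorem theorem3p3 (R : realType) (mu : probability PP R) (mu_haar : is_haar mu)
    (k s q : nat) (k_gt0 : (0 < k)%N) (s_gt0 : (0 < s)%N) (q_gt0 : (0 < q)%N) :
  (forall t eta xi : PP,
     gsum R k s t eta xi
     = 2 ^ ((3 * s + k)%N%:Z - (\rank (Dmx s k t eta xi))%:Z)) /\
  (\int[(mu \x mu) \x mu]_x (gsum R k s x.1.1 x.1.2 x.2 ^+ q)%:E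
   = (2 ^+ ((3 * s + k) * q) * 2 ^ (- (3 * k)%N%:Z - (3 * s)%N%:Z + 3%:Z)
      * \sum_(0 <= i < (minn (3 * s) k).+1)
          (Gamma s k i)%:R * 2 ^- (q * i))%:E)%E.
Proof.
split; first by move=> t eta xi; exact: gsum_rank.
case: k k_gt0 => // k _; case: s s_gt0 => // s _.
have gE t u v : gsum R k.+1 s.+1 t u v ^+ q
    = 2 ^+ ((3 * s.+1 + k.+1) * q) * 2 ^- (q * \rank (Dmx s.+1 k.+1 t u v)).
  rewrite gsum_rank expfzDr ?pnatr_eq0 // -exprnP exprMn -exprM.
  by rewrite -exprnN exprVn -exprM (mulnC q).
rewrite (@haar3_integral _ _ (s.+1 + k.+1).-1
  (fun t u v => gsum R k.+1 s.+1 t u v ^+ q)) //; last 2 first.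
- by move=> t u v; rewrite gE mulr_ge0 ?invr_ge0 ?exprn_ge0.
- move=> t u v; rewrite !gE; congr (_ * 2 ^- (q * \rank _)).
  by congr (col_mx (col_mx _ _) _);
    apply: eq_persym_mx => i lti; rewrite npolyI_truncI.
congr EFin; under eq_bigr do rewrite gE.
rewrite (sum_npolyI_Dmx s k
  (fun M => 2 ^+ ((3 * s.+1 + k.+1) * q) * 2 ^- (q * \rank M) : R)).
rewrite -mulr_sumr.
rewrite (sum_persym3_rank _ _ (fun i => 2 ^- (q * i) : R)) mulrA; congr (_ * _).
(* With n = s + k - 1 for the original [s] and [k], the exponent -3n is -3k - 3s + 3. *)
rewrite mulrC; congr (_ * _); rewrite exprnN; congr (_ ^ _); lia.
Qed.
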